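(* Let $K$ be a field of characteristic zero, let $n\ge 9$, and let $W_n$ be the $n$-dimensional Witt Lie algebra over $K$, with basis $(e_1,\dots,e_n)$ as defined in the context. Let $t_1,t_2,t_3\in\mathrm{End}(W_n)$ be the linear maps given, for $x=\sum_{i=1}^n x_ie_i$, by $t_1(x)=x_2e_n$, $t_2(x)=x_2e_{n-1}+x_3e_n$, $t_3(x)=x_2e_{n-2}+x_3e_{n-1}+x_4e_n$. Then $\mathrm{AID}(W_n)=\mathrm{Inn}(W_n)\oplus\langle t_1,t_2,t_3\rangle$.
   Context: For a finite-dimensional Lie algebra $\mathfrak{g}$ over a field $K$, let $\mathrm{Inn}(\mathfrak{g})=\{\mathrm{ad}(x)\mid x\in\mathfrak{g}\}$ be the inner derivations. A derivation $D$ of $\mathfrak{g}$ is called almost inner if $D(x)\in[\mathfrak{g},x]=\{[y,x]\mid y\in\mathfrak{g}\}$ for all $x\in\mathfrak{g}$. The space of almost inner derivations is denoted $\mathrm{AID}(\mathfrak{g})$. The Witt Lie algebra $W_n$ ($n\ge5$) has basis $(e_1,\dots,e_n)$ and Lie brackets $$[e_1,e_j]=e_{j+1},\quad 2\le j\le n-1,$$ $$[e_i,e_j]=\frac{6(j-i)}{j(j-1)\binom{j+i-2}{i-2}}\,e_{i+j},\quad 2\le i\le\frac{n-1}{2},\ i+1\le j\le n-i,$$ with all other brackets of basis vectors zero except those forced by antisymmetry. $\langle\cdot\rangle$ denotes the $K$-linear span and $\oplus$ the direct sum of vector spaces. *)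

(* Defs.v *)
From HB Require Import structures.
From mathcomp Require Import all_boot all_order all_algebra.
From mathcomp Require Import zify ring.

Set Implicit Arguments.
Unset Strict Implicit.
Unset Printing Implicit Defensive.

Import GRing.Theory.
Local Open Scope ring_scope.

HB.mixin Record hasLieBracket (K : fieldType) L of Vector K L := {
  lie : L -> L -> L;
  lie_linearl : forall y : L, linear (lie^~ y);
  lie_linearr : forall x : L, linear (lie x);
  liexx : forall x : L, lie x x = 0;
  lie_jacobi : forall x y z : L,
    lie x (lie y z) + lie y (lie z x) + lie z (lie x y) = 0
}.

#[short(type="lieAlgType")]
HB.structure Definition LieAlgebra (K : fieldType) :=
  { L of Vector K L & hasLieBracket K L }.

Section Derivations.
Variables (K : fieldType) (L : lieAlgType K).
Implicit Types (x y : L) (D : 'End(L)).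

HB.instance Definition _ x := GRing.isLinear.Build K L L *:%R (lie x) (lie_linearr x).

Definition ad x : 'End(L) := linfun (lie x).

Lemma adE x y : ad x y = lie x y.
Proof. exact: lfunE. Qed.

Lemma ad_is_linear : linear ad.
Proof.
move=> a x y; apply/lfunP => z.
by rewrite add_lfunE scale_lfunE !adE (lie_linearl z).
Qed.

HB.instance Definition _ := GRing.isLinear.Build K L 'End(L) *:%R ad ad_is_linear.

Definition Inn : {vspace 'End(L)} := limg (linfun ad).

Lemma InnP D : reflect (exists x, D = ad x) (D \in Inn).
Proof.
apply: (iffP memv_imgP) => [[x _ ->]|[x ->]]; exists x; rewrite ?lfunE //.
by rewrite memvf.
Qed.

Definition derivation D :=
  forall x y, D (lie x y) = lie (D x) y + lie x (D y).

Definition AID D := derivation D /\ forall x, exists y, D x = lie y x.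

End Derivations.

Arguments Inn {K} L.

Section WittAlgebra.
Variables (K : fieldType) (n : nat).
Implicit Types x y : 'rV[K]_n.

(* Basis vectors and coordinates are numbered from 1 to n; both are 0 when the
   number is out of this range. *)
Definition basis_vec (k : nat) : 'rV[K]_n := \row_(m < n) (m.+1 == k)%:R.

Definition coordinate (k : nat) x : K := \sum_(m < n | m.+1 == k) x 0 m.

(* The coefficient of e_(i + j) in [e_i, e_j] for i < j, and 0 otherwise. *)
Definition witt_coef_lt (i j : nat) : K :=
  if (i == 1)%N && (2 <= j <= n.-1)%N then 1
  else if [&& (2 <= i)%N, (2 * i <= n.-1)%N, (i.+1 <= j)%N & (j <= n - i)%N]
  then (6 * (j - i))%:R / (j * (j - 1) * 'C(j + i - 2, i - 2))%:R
  else 0.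

Definition witt_coef (i j : nat) : K := witt_coef_lt i j - witt_coef_lt j i.

Definition witt_bracket x y : 'rV[K]_n :=
  \sum_(i < n) \sum_(j < n)
    (x 0 i * y 0 j * witt_coef i.+1 j.+1) *: basis_vec (i.+1 + j.+1).

Lemma basis_vec_gt k : (n < k)%N -> basis_vec k = 0.
Proof.
move=> nk; apply/rowP => m; rewrite !mxE.
by case: eqP => // mk; have := ltn_ord m; rewrite mk leqNgt nk.
Qed.

Lemma basis_vec_ord (i : 'I_n) : basis_vec i.+1 = delta_mx 0 i.
Proof. by apply/rowP => m; rewrite !mxE eqxx eqSS. Qed.

Lemma coordinate_ord (i : 'I_n) x : coordinate i.+1 x = x 0 i.
Proof. by rewrite /coordinate (big_pred1 i). Qed.

Lemma witt_bracket_basis i j : (0 < i <= n)%N -> (0 < j <= n)%N ->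
  witt_bracket (basis_vec i) (basis_vec j) = witt_coef i j *: basis_vec (i + j).
Proof.
case: i => // i /= Hi; case: j => // j /= Hj; rewrite /witt_bracket.
rewrite (bigD1 (Ordinal Hi)) //= (bigD1 (Ordinal Hj)) //= !mxE !eqxx !mul1r.
rewrite !big1 ?addr0 // => [a | b] neq.
  by rewrite big1 // => b _; rewrite !mxE eqSS (negPf neq : (a : nat) == i = false) !mul0r scale0r.
by rewrite !mxE !eqSS (negPf neq : (b : nat) == j = false) mulr0 mul0r scale0r.
Qed.

Lemma witt_bracket_linearl y : linear (witt_bracket^~ y).
Proof.
move=> a x x'; rewrite /witt_bracket scaler_sumr -big_split; apply: eq_bigr => i _ /=.
rewrite scaler_sumr -big_split; apply: eq_bigr => j _ /=.
by rewrite !mxE scalerA -scalerDl; congr (_ *: _); ring.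
Qed.

Lemma witt_bracket_linearr x : linear (witt_bracket x).
Proof.
move=> a y y'; rewrite /witt_bracket scaler_sumr -big_split; apply: eq_bigr => i _ /=.
rewrite scaler_sumr -big_split; apply: eq_bigr => j _ /=.
by rewrite !mxE scalerA -scalerDl; congr (_ *: _); ring.
Qed.

HB.instance Definition _ x := GRing.isLinear.Build K 'rV[K]_n 'rV[K]_n *:%R
  (witt_bracket x) (witt_bracket_linearr x).

Lemma witt_coefC i j : witt_coef i j = - witt_coef j i.
Proof. by rewrite /witt_coef opprB. Qed.

Lemma witt_coefxx i : witt_coef i i = 0.
Proof. by rewrite /witt_coef subrr. Qed.

Lemma witt_bracketC x y : witt_bracket x y = - witt_bracket y x.
Proof.
rewrite /witt_bracket [in RHS]exchange_big -sumrN; apply: eq_bigr => i _ /=.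
rewrite -sumrN; apply: eq_bigr => j _ /=.
by rewrite -scaleNr addnC witt_coefC; congr (_ *: _); ring.
Qed.

End WittAlgebra.

Section WittJacobi.
Variables (K : fieldType) (charK : [pchar K] =i pred0) (n : nat).
Implicit Types x y z : 'rV[K]_n.
Local Notation c := (witt_coef K n).
Local Notation e := (basis_vec K n).

(* e_k = witt_scale k * L_k, where [L_i, L_j] = (j - i) L_(i + j). *)
Let witt_scale (k : nat) : K := if k is k'.+2 then (6 * k'`!)%:R else 1.

Let natr_neq0 k : (0 < k)%N -> k%:R != 0 :> K.
Proof. by move=> k0; rewrite ((pcharf0P K).1 charK) -lt0n. Qed.

Let scale_neq0 k : witt_scale k != 0.
Proof.
by case: k => [|[|k]]; rewrite /= ?oner_eq0 // natr_neq0 // muln_gt0 fact_gt0.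
Qed.

Let witt_coef_ltE i j : (0 < i < j)%N -> (i + j <= n)%N ->
  c i j = (j%:R - i%:R) * witt_scale i * witt_scale j / witt_scale (i + j).
Proof.
move=> /andP[i0 ij] ijn; rewrite /witt_coef [X in _ - X](_ : _ = 0); last first.
  rewrite /witt_coef_lt; case: ifP => [|_]; first lia.
  by case: ifP => //; lia.
rewrite subr0 -natrB 1?ltnW //; case: i i0 ij ijn => [|[|i]] // _.
  case: j => [|[|j]] // _ jn; rewrite /witt_coef_lt /=.
  case: ifP => [_|]; last lia.
  rewrite mulr1 -natrM !factS; apply/esym/eqP; rewrite subSS subn0.
  by rewrite mulnCA divff // natr_neq0 // !muln_gt0 fact_gt0.
case: j => [|[|j]] //; rewrite !ltnS => ij ijn.
rewrite /witt_coef_lt /=.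
case: ifP => [_|]; last lia.
rewrite addSn addnC addSn addSn addnC addnS /= !subSS !subn0.
have den1 : (j.+2 * j.+1 * 'C((j.+1 + i).+1, i))%:R != 0 :> K.
  by rewrite natr_neq0 // !muln_gt0 /= bin_gt0; lia.
have den2 : (6 * ((i + j.+1).+1)`!)%:R != 0 :> K.
  by rewrite natr_neq0 // muln_gt0 fact_gt0.
rewrite -!natrM; apply/eqP; rewrite eqr_div // -!natrM; apply/eqP; congr (_%:R).
have := @bin_fact (i + j.+2) i (leq_addr _ _).
rewrite addKn [(j.+2)`!]factS [(j.+1)`!]factS => binE.
move: binE; rewrite !addnS !addSn (addnC j i); move: ('C(_, _)) (i`!) (j`!) (j - i)%N => C a b d <-.
ring.
Qed.

Let witt_coefE i j : (0 < i)%N -> (0 < j)%N -> (i + j <= n)%N ->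
  c i j = (j%:R - i%:R) * witt_scale i * witt_scale j / witt_scale (i + j).
Proof.
move=> i0 j0 ijn; case: (ltngtP i j) => [ij|ji|->]; last 1 first.
- by rewrite witt_coefxx subrr !mul0r.
- by rewrite witt_coef_ltE ?i0.
by rewrite witt_coefC witt_coef_ltE ?j0 1?addnC // [(i + j)%N]addnC; ring.
Qed.

Let witt_coef_jacobi i j k : (0 < i)%N -> (0 < j)%N -> (0 < k)%N ->
  (i + j + k <= n)%N ->
  c j k * c i (j + k) + c k i * c j (k + i) + c i j * c k (i + j) = 0.
Proof.
move=> i0 j0 k0 ijkn; rewrite !witt_coefE; try lia.
rewrite (addnC j (k + i)) (addnC k (i + j)) (_ : (k + i + j = i + (j + k))%N); last lia.
rewrite (_ : (i + j + k = i + (j + k))%N); last lia.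
rewrite !natrD; have := scale_neq0 (i + (j + k)).
have := scale_neq0 (j + k); have := scale_neq0 (k + i); have := scale_neq0 (i + j).
move=> ? ? ? ?; field; exact/and4P.
Qed.

Let bracket_basis_vec x k : (0 < k)%N -> 
  witt_bracket x (e k) = \sum_(i < n) (x 0 i * c i.+1 k) *: e (i.+1 + k).
Proof.
move=> k0; rewrite /witt_bracket; apply: eq_bigr => i _.
have [kn|nk] := leqP k n; last first.
  rewrite [e (_ + k)]basis_vec_gt ?scaler0; last lia.
  by rewrite big1 // => j _; rewrite basis_vec_gt // mxE mulr0 mul0r scale0r.
case: k k0 kn => // k _ kn; rewrite (bigD1 (Ordinal kn)) //= !mxE eqxx mulr1.
rewrite big1 ?addr0 // => j neq.
by rewrite !mxE eqSS (negPf neq : (j : nat) == k = false) mulr0 mul0r scale0r.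
Qed.

Let double_bracketE x y z : witt_bracket x (witt_bracket y z) =
  \sum_(i < n) \sum_(j < n) \sum_(k < n) (x 0 i * y 0 j * z 0 k *
    (c j.+1 k.+1 * c i.+1 (j.+1 + k.+1))) *: e (i.+1 + (j.+1 + k.+1)).
Proof.
rewrite {2}/witt_bracket linear_sum [RHS]exchange_big; apply: eq_bigr => j _ /=.
rewrite linear_sum [RHS]exchange_big; apply: eq_bigr => k _ /=.
rewrite linearZ /= bracket_basis_vec ?addn_gt0 // scaler_sumr.
by apply: eq_bigr => i _; rewrite scalerA; congr (_ *: _); ring.
Qed.

Lemma witt_bracket_jacobi x y z :
  witt_bracket x (witt_bracket y z) + witt_bracket y (witt_bracket z x)
    + witt_bracket z (witt_bracket x y) = 0.
Proof.
have rot (F : 'I_n -> 'I_n -> 'I_n -> 'rV[K]_n) :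
    \sum_i \sum_j \sum_k F i j k = \sum_k \sum_i \sum_j F i j k.
  rewrite [RHS]exchange_big; apply: eq_bigr => i _ /=.
  by rewrite exchange_big.
rewrite !double_bracketE [X in _ + X + _]rot [X in _ + X]rot [X in _ + X]rot.
rewrite -!big_split; apply: big1 => i _ /=.
rewrite -!big_split; apply: big1 => j _ /=.
rewrite -!big_split; apply: big1 => k _ /=.
rewrite (_ : (j.+1 + (k.+1 + i.+1) = i.+1 + (j.+1 + k.+1))%N); last lia.
rewrite (_ : (k.+1 + (i.+1 + j.+1) = i.+1 + (j.+1 + k.+1))%N); last lia.
rewrite -!scalerDl; have [le|gt] := leqP (i.+1 + (j.+1 + k.+1)) n; last first.
  by rewrite basis_vec_gt ?scaler0.
have J := @witt_coef_jacobi i.+1 j.+1 k.+1 isT isT isT.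
rewrite -addnA in J; move: (J le) => {}J.
rewrite [X in X *: _](_ : _ = 0) ?scale0r //.
by rewrite -[RHS](mulr0 (x 0 i * y 0 j * z 0 k)) -J; ring.
Qed.

Lemma witt_bracketxx x : witt_bracket x x = 0.
Proof.
have /eqP := witt_bracketC x x; rewrite -subr_eq0 opprK -mulr2n -scaler_nat.
by rewrite scaler_eq0 (negPf (natr_neq0 _)) // => /eqP.
Qed.

End WittJacobi.

(* The bracket is alternating and satisfies the Jacobi identity only because the
   characteristic is 0, hence the dependency of the type on charK. *)
Definition witt (K : fieldType) (charK : [pchar K] =i pred0) (n : nat) : Type :=
  'rV[K]_n.

Section WittLieAlgebra.
Variables (K : fieldType) (charK : [pchar K] =i pred0) (n : nat).
Local Notation W := (witt charK n).

HB.instance Definition _ := Vector.copy W 'rV[K]_n.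
HB.instance Definition _ := hasLieBracket.Build K W
  (@witt_bracket_linearl K n) (@witt_bracket_linearr K n)
  (@witt_bracketxx K charK n) (@witt_bracket_jacobi K charK n).

Definition witt_e (k : nat) : W := basis_vec K n k.
Definition witt_coord (k : nat) (x : W) : K := coordinate k x.

Lemma witt_coord_is_linear k : linear (witt_coord k : W -> K^o).
Proof.
move=> a x y; rewrite /witt_coord /coordinate scaler_sumr -big_split.
by apply: eq_bigr => m _; rewrite !mxE.
Qed.

HB.instance Definition _ k :=
  GRing.isLinear.Build K W K^o *:%R (witt_coord k) (witt_coord_is_linear k).

Lemma witt_lieE i j : (0 < i <= n)%N -> (0 < j <= n)%N ->
  lie (witt_e i) (witt_e j) = witt_coef K n i j *: witt_e (i + j).
Proof. exact: witt_bracket_basis. Qed.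

Lemma witt_coordK (x : W) :
  \sum_(1 <= k < n.+1) witt_coord k x *: witt_e k = x.
Proof.
rewrite big_add1 big_mkord [RHS](row_sum_delta x); apply: eq_bigr => i _.
by rewrite /witt_coord coordinate_ord /witt_e basis_vec_ord.
Qed.

Definition elem_map (a b : nat) (x : W) : W := witt_coord a x *: witt_e b.

Lemma elem_map_is_linear a b : linear (elem_map a b).
Proof. by move=> c x y; rewrite /elem_map linearP scalerDl scalerA. Qed.

HB.instance Definition _ a b :=
  GRing.isLinear.Build K W W *:%R (elem_map a b) (elem_map_is_linear a b).

Definition t1 : 'End(W) := linfun (fun x => witt_coord 2 x *: witt_e n).

Definition t2 : 'End(W) := linfun (fun x =>
  witt_coord 2 x *: witt_e (n - 1) + witt_coord 3 x *: witt_e n).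

Definition t3 : 'End(W) := linfun (fun x =>
  witt_coord 2 x *: witt_e (n - 2) + witt_coord 3 x *: witt_e (n - 1)
  + witt_coord 4 x *: witt_e n).

Lemma t1E x : t1 x = witt_coord 2 x *: witt_e n.
Proof. by rewrite (lfunE (elem_map 2 n)). Qed.

Lemma t2E x :
  t2 x = witt_coord 2 x *: witt_e (n - 1) + witt_coord 3 x *: witt_e n.
Proof. by rewrite (lfunE (elem_map 2 (n - 1) \+ elem_map 3 n)). Qed.

Lemma t3E x :
  t3 x = witt_coord 2 x *: witt_e (n - 2) + witt_coord 3 x *: witt_e (n - 1)
         + witt_coord 4 x *: witt_e n.
Proof.
by rewrite (lfunE (elem_map 2 (n - 2) \+ elem_map 3 (n - 1) \+ elem_map 4 n)).
Qed.

End WittLieAlgebra.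

(* Main.v *)
Require Import Defs.
From HB Require Import structures.
From mathcomp Require Import all_boot all_order all_algebra.
From mathcomp Require Import zify ring.

Set Implicit Arguments.
Unset Strict Implicit.
Unset Printing Implicit Defensive.

Import GRing.Theory.
Local Open Scope ring_scope.

(** Everything is expressed through the maps [shift k], which send [e_j] to
    [e_(j + k)] for [j >= 2] and kill [e_1]: [shift 1] is [ad e_1], and
    [t_1], [t_2], [t_3] are [shift (n - 2)], [shift (n - 3)], [shift (n - 4)].

    Let [D] be almost inner. Then [D e_1 = [y, e_1]] for some [y], so
    subtracting [ad y] gives an almost inner [D] with [D e_1 = 0]. Such a
    derivation commutes with [ad e_1], and [e_(j + 1) = [e_1, e_j]] for
    [j >= 2], so [D] is determined by [v = D e_2]: it is the sum of the
    [v_(k + 2) shift k] (lemma [shift_cent]). Brackets have no component on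
    [e_1] and [e_2], so only [k >= 1] occurs. The term [k = 1] is inner. For
    [k >= 2] with [k + 5 <= n], applying [D] to [[e_2, e_3] = e_5] and
    comparing the components on [e_(k + 5)] gives a linear equation on
    [v_(k + 2)] whose coefficient is nonzero (lemmas [witt_coef_defect] and
    [shift_coef_eq0]). Only [k = n - 4], [n - 3], [n - 2] survive.

    Conversely these three shifts are derivations because the identity on
    [e_i], [e_j] with [i, j >= 2] only involves indices greater than [n], apart
    from the trivial case [i = j = 2] (lemma [shift_derivation]). They are
    almost inner by a leading term argument: if [e_m] is the first basis vector
    occurring in [x], then the image of [[-, x]] contains every [e_l] with
    [l > 2 m], since [[e_(l - m), x]] has leading term a nonzero multiple of
    [e_l] (lemma [lead_bracket_image]). A shift by [k] sends [x] to vectors of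
    index at least [m + k], and [m + k > 2 m] as soon as [m <= 4 < k]; for
    [m > 4] the image is zero. This is where [n >= 9] enters.

    The sum is direct because an inner derivation that is a combination of the
    three shifts kills [e_1], which forces [y] into the span of [e_1] and
    [e_n]; then [[y, e_2]] has no component on the last three basis vectors
    (lemma [ad_eq_shifts_eq0]). *)

(** * Bilinearity of the bracket, and the space of almost inner derivations *)

Section LieAlgebraFacts.
Variables (K : fieldType) (L : lieAlgType K).
Implicit Types (x y : L) (D : 'End(L)).

Lemma lieDl x x' y : lie (x + x') y = lie x y + lie x' y.
Proof. by have := lie_linearl y 1 x x'; rewrite !scale1r. Qed.

Lemma lie0l y : lie 0 y = 0 :> L.
Proof. by apply: (addrI (lie 0 y)); rewrite -lieDl !addr0. Qed.

Lemma lieZl a x y : lie (a *: x) y = a *: lie x y.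
Proof. by have := lie_linearl y a x 0; rewrite lie0l !addr0. Qed.

Lemma lieC x y : lie x y = - lie y x.
Proof.
apply/eqP; rewrite -addr_eq0; apply/eqP.
by have := liexx (x + y); rewrite lieDl !raddfD /= !liexx add0r addr0.
Qed.

Lemma lie_suml I r (P : pred I) (F : I -> L) y :
  lie (\sum_(i <- r | P i) F i) y = \sum_(i <- r | P i) lie (F i) y.
Proof.
by apply: (big_morph (lie^~ y)) => [x x'|]; [exact: lieDl | exact: lie0l].
Qed.

Lemma lieZr a x y : lie x (a *: y) = a *: lie x y.
Proof. exact: linearZ. Qed.

Lemma lie_sumr I r (P : pred I) (F : I -> L) x :
  lie x (\sum_(i <- r | P i) F i) = \sum_(i <- r | P i) lie x (F i).
Proof. exact: linear_sum. Qed.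

Lemma ad_derivation x : derivation (ad x).
Proof.
move=> y z; rewrite !adE; apply/eqP; rewrite -subr_eq0 opprD addrA; apply/eqP.
rewrite -[RHS](lie_jacobi x y z) (lieC (lie x y)) opprK (lieC z x) linearN /=.
by rewrite addrAC.
Qed.

Lemma AID_ad x : AID (ad x).
Proof. by split=> [|y]; [exact: ad_derivation | exists x; rewrite adE]. Qed.

Lemma AIDD D D' : AID D -> AID D' -> AID (D + D').
Proof.
move=> [dD iD] [dD' iD']; split=> [x y | x].
  by rewrite !add_lfunE dD dD' lieDl raddfD /= addrACA.
have [y Dx] := iD x; have [y' D'x] := iD' x.
by exists (y + y'); rewrite add_lfunE Dx D'x lieDl.
Qed.

Lemma AIDZ a D : AID D -> AID (a *: D).
Proof.
move=> [dD iD]; split=> [x y | x].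
  by rewrite !scale_lfunE dD scalerDr lieZl linearZ.
by have [y Dx] := iD x; exists (a *: y); rewrite scale_lfunE Dx lieZl.
Qed.

End LieAlgebraFacts.

(** * Structure constants and coordinates of the Witt algebra *)

Section Witt.
Variables (K : fieldType) (charK : [pchar K] =i pred0) (n : nat).
Local Notation W := (witt charK n).
Local Notation e := (witt_e charK n).
Local Notation c := (witt_coef K n).
Implicit Types (x y z : W) (D : 'End(W)).

Lemma natr_neq0 k : (0 < k)%N -> k%:R != 0 :> K.
Proof. by move=> k0; rewrite ((pcharf0P K).1 charK) -lt0n. Qed.

Lemma witt_coef_ltn i j : (i < j)%N -> c i j = witt_coef_lt K n i j.
Proof.
move=> ij; rewrite /witt_coef [X in _ - X](_ : _ = 0) ?subr0 //.
rewrite /witt_coef_lt; case: ifP => [|_]; first lia.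
by case: ifP => //; lia.
Qed.

Lemma witt_coef1 j : (2 <= j < n)%N -> c 1 j = 1.
Proof.
move=> j2; rewrite witt_coef_ltn; last lia.
by rewrite /witt_coef_lt ifT //; lia.
Qed.

Lemma witt_coef_ge2 i j : (2 <= i < j)%N -> (i + j <= n)%N ->
  c i j = (6 * (j - i))%:R / (j * (j - 1) * 'C(j + i - 2, i - 2))%:R.
Proof.
move=> ij ijn; rewrite witt_coef_ltn; last lia.
rewrite /witt_coef_lt; case: ifP => [|_]; first lia.
by case: ifP => //; lia.
Qed.

Lemma witt_coef_neq0 i j : (0 < i)%N -> (0 < j)%N -> i != j ->
  (i + j <= n)%N -> c i j != 0.
Proof.
have ltcase p q : (0 < p < q)%N -> (p + q <= n)%N -> c p q != 0.
  move=> pq pqn; have [p1|p2] := leqP p 1.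
    have -> : p = 1%N by lia.
    by rewrite witt_coef1 ?oner_eq0 //; lia.
  rewrite witt_coef_ge2 ?mulf_neq0 ?invr_neq0 ?natr_neq0 //; try lia.
  by rewrite !muln_gt0 bin_gt0; lia.
move=> i0 j0; rewrite neq_ltn => /orP[ij|ji] ijn; first by rewrite ltcase // i0.
by rewrite witt_coefC oppr_eq0 ltcase ?j0 // addnC.
Qed.

(** Applied to [[e_2, e_3] = e_5], the Leibniz rule for [shift k] compares the
    left-hand side with [1]. The difference is
    [- (k - 1) (k^2 + k + 6) / ((k + 1) (k + 2) (k + 3))], so among positive
    [k] only [k = 1], the inner case, satisfies the rule. *)
Lemma witt_coef_defect k : (1 < k)%N -> (k + 5 <= n)%N ->
  c 2 (k + 3) - c 3 (k + 2) != 1.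
Proof.
(* With k = m + 1, the factor k^2 + k + 6 becomes m^2 + 3 m + 8. *)
case: k => // m m0 mn.
have c2 : c 2 (m.+1 + 3) = (6 * (m + 2))%:R / ((m + 4) * (m + 3))%:R.
  rewrite witt_coef_ge2 ?subnn ?bin0 ?muln1; try lia.
  by congr (_%:R / _%:R); lia.
have c3 : c 3 (m.+1 + 2) = (6 * m)%:R / ((m + 3) * (m + 2) * (m + 4))%:R.
  rewrite witt_coef_ge2 ?bin1; try lia.
  by congr (_%:R / _%:R); lia.
have num0 : (m * (m * m + 3 * m + 8))%:R != 0 :> K by apply: natr_neq0; lia.
have den2 : (m + 2)%:R != 0 :> K by apply: natr_neq0; lia.
have den3 : (m + 3)%:R != 0 :> K by apply: natr_neq0; lia.
have den4 : (m + 4)%:R != 0 :> K by apply: natr_neq0; lia.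
rewrite c2 c3 -subr_eq0; move: num0 den2 den3 den4.
rewrite !(natrM, natrD); move: (m%:R) => r num0 den2 den3 den4.
rewrite (_ : _ - _ = - (r * (r * r + 3%:R * r + 8%:R)
    / ((r + 4%:R) * (r + 3%:R) * (r + 2%:R)))); last first.
  by field; rewrite den2 den3 den4.
by rewrite oppr_eq0 mulf_neq0 // invr_neq0 // !mulf_neq0.
Qed.

Lemma witt_coord0 x : witt_coord 0 x = 0.
Proof. by rewrite /witt_coord /coordinate big_pred0. Qed.

Lemma witt_coordZ k a x : witt_coord k (a *: x) = a * witt_coord k x.
Proof. exact: linearZ. Qed.

Lemma witt_coordv0 k : witt_coord k (0 : W) = 0.
Proof. exact: linear0. Qed.

Lemma witt_coordD k x y : witt_coord k (x + y) = witt_coord k x + witt_coord k y.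
Proof. exact: linearD. Qed.

Lemma witt_coordN k x : witt_coord k (- x) = - witt_coord k x.
Proof. exact: linearN. Qed.

Lemma witt_coord_sum k I r (P : pred I) (F : I -> W) :
  witt_coord k (\sum_(i <- r | P i) F i) = \sum_(i <- r | P i) witt_coord k (F i).
Proof. exact: linear_sum. Qed.

Lemma witt_coord_e k l : (0 < l <= n)%N -> witt_coord l (e k) = (l == k)%:R.
Proof.
case: l => // l /= ln.
by rewrite /witt_coord (coordinate_ord (Ordinal ln)) /witt_e mxE.
Qed.

Lemma witt_e_gt k : (n < k)%N -> e k = 0.
Proof. exact: basis_vec_gt. Qed.

Lemma witt_coordP x y :
  (forall k, (0 < k <= n)%N -> witt_coord k x = witt_coord k y) -> x = y.
Proof.
move=> xy; rewrite -(witt_coordK x) -(witt_coordK y).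
by apply: eq_big_nat => k kn; rewrite xy.
Qed.

Lemma witt_endP D D' : (forall k, (0 < k)%N -> D (e k) = D' (e k)) -> D = D'.
Proof.
move=> DD'; apply/lfunP => x; rewrite -(witt_coordK x) !linear_sum.
by apply: eq_big_nat => k /andP[k0 _]; rewrite !linearZ /= DD'.
Qed.

Lemma witt_lie_e i j : (0 < i)%N -> (0 < j)%N ->
  lie (e i) (e j) = c i j *: e (i + j).
Proof.
move=> i0 j0; have [ni|le_in] := ltnP n i.
  by rewrite (witt_e_gt ni) lie0l witt_e_gt ?scaler0 //; lia.
have [nj|le_jn] := ltnP n j.
  by rewrite (witt_e_gt nj) linear0 witt_e_gt ?scaler0 //; lia.
by rewrite witt_lieE ?i0 ?j0.
Qed.

Lemma witt_lie_e1 j : (2 <= j)%N -> lie (e 1) (e j) = e j.+1.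
Proof.
move=> j2; rewrite witt_lie_e ?(ltnW j2) // add1n.
have [nj|jn] := leqP n j; first by rewrite witt_e_gt ?scaler0.
by rewrite witt_coef1 ?scale1r // j2.
Qed.

(** Truncated subtraction makes this hold without a hypothesis comparing [l]
    and [i]: if [l <= i], the right-hand side involves coordinate 0, which is
    always 0. *)
Lemma witt_coord_lie_e i l x : (0 < i)%N -> (0 < l <= n)%N ->
  witt_coord l (lie (e i) x) = c i (l - i) * witt_coord (l - i) x.
Proof.
move=> i0 ln; rewrite -{1}(witt_coordK x) lie_sumr witt_coord_sum.
rewrite big_nat (eq_bigr (fun k => if k == (l - i)%N then
    c i (l - i) * witt_coord (l - i) x else 0)); last first.
  move=> k /andP[k0 _]; rewrite lieZr witt_lie_e // !witt_coordZ witt_coord_e //.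
  rewrite (_ : (l == i + k)%N = (k == l - i)%N); last by apply/eqP/eqP; lia.
  by case: eqP => [->|_]; rewrite ?mulr0 // mulr1 mulrC.
rewrite -big_nat -big_mkcond /=; have [li|il] := leqP l i.
  rewrite (_ : l - i = 0)%N ?witt_coord0 ?mulr0; last lia.
  by rewrite big1.
rewrite big_nat1_eq ifT //; lia.
Qed.

(** The bracket is graded and [[e_1, e_1] = 0], so the derived algebra starts in
    degree [1 + 2]. *)
Lemma witt_coord_lie_lt3 l x y : (l < 3)%N -> witt_coord l (lie x y) = 0.
Proof.
case: (posnP l) => [->|l0 l3]; first by rewrite witt_coord0.
have [nl|ln] := ltnP n l.
  rewrite /witt_coord /coordinate big_pred0 // => i.
  by apply/eqP; have := ltn_ord i; lia.
rewrite -(witt_coordK x) lie_suml witt_coord_sum big_nat big1 // => i /andP[i0 _].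
rewrite lieZl witt_coordZ witt_coord_lie_e ?l0 //.
have [->|i1] := eqVneq i 1%N.
  have [->|->] : l = 1%N \/ l = 2%N by lia.
    by rewrite witt_coord0 !mulr0.
  by rewrite witt_coefxx mul0r mulr0.
by rewrite (_ : l - i = 0)%N ?witt_coord0 ?mulr0 //; lia.
Qed.

(** If [m] is the leading index of [x], then [[e_(k - m), x]] has leading index
    [k] whenever [k - m] differs from [m], so the coordinates of [z] can be
    removed one at a time, in increasing order. The bound [2 * m] keeps clear of
    the vanishing bracket of [e_m] with itself. *)
Lemma lead_bracket_image m x z :
  witt_coord m x != 0 -> (forall j, (j < m)%N -> witt_coord j x = 0) ->
  (forall l, (0 < l <= 2 * m)%N -> witt_coord l z = 0) ->
  exists y, z = lie y x.
Proof.
move=> xm x_lt z_le.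
have m0 : (0 < m)%N by case: (m) xm => //; rewrite witt_coord0 eqxx.
suff image_ge d k w : (2 * m < k)%N -> (n < k + d)%N ->
    (forall l, (0 < l < k)%N -> witt_coord l w = 0) -> exists y, w = lie y x.
  by apply: (image_ge n (2 * m).+1) => [//||l lm]; [lia | exact: z_le].
(* d bounds the number n - k + 1 of coordinates of w still to be removed. *)
elim: d => [|d IHd] in k w * => mk kd w_lt.
  exists 0; rewrite lie0l; apply: witt_coordP => l ln.
  by rewrite w_lt ?witt_coordv0 //; lia.
have [nk|kn] := ltnP n k; first by apply: (IHd k) => //; lia.
have cm : c (k - m) m * witt_coord m x != 0.
  by rewrite mulf_neq0 // witt_coef_neq0 //; lia.
pose a := witt_coord k w / (c (k - m) m * witt_coord m x).
have [||l lk|y wy] := IHd k.+1 (w - a *: lie (e (k - m)) x); try lia.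
  have [ln|nl] := leqP l n; last by lia.
  rewrite witt_coordD witt_coordN witt_coordZ witt_coord_lie_e; try lia.
  have [->|l_neq_k] := eqVneq l k.
    by rewrite (_ : k - (k - m) = m)%N ?divfK ?subrr //; lia.
  by rewrite w_lt ?x_lt ?mulr0 ?subr0 //; lia.
by exists (y + a *: e (k - m)); rewrite lieDl lieZl -wy subrK.
Qed.

Lemma derivation_basis D :
  (forall i j, (0 < i < j)%N ->
     D (lie (e i) (e j)) = lie (D (e i)) (e j) + lie (e i) (D (e j))) ->
  derivation D.
Proof.
move=> D_lt.
have De i j : (0 < i)%N -> (0 < j)%N ->
    D (lie (e i) (e j)) = lie (D (e i)) (e j) + lie (e i) (D (e j)).
  move=> i0 j0; case: (ltngtP i j) => [ij|ji|->].
  - by rewrite D_lt ?i0.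
  - rewrite lieC linearN /= D_lt ?j0 // opprD addrC.
    by rewrite -(lieC (D (e i))) -(lieC (e i)).
  - by rewrite liexx linear0 [lie (e j) _]lieC subrr.
have Dx i y : (0 < i)%N -> D (lie (e i) y) = lie (D (e i)) y + lie (e i) (D y).
  move=> i0; rewrite -(witt_coordK y) !lie_sumr !(linear_sum D) lie_sumr -big_split /=.
  by apply: eq_big_nat => j /andP[j0 _]; rewrite !(lieZr, linearZ) /= De // scalerDr.
move=> x y; rewrite -(witt_coordK x) !lie_suml !(linear_sum D) lie_suml -big_split /=.
apply: eq_big_nat => i /andP[i0 _].
by rewrite linearZ !lieZl linearZ /= Dx // scalerDr.
Qed.

(** * Shifts, their derivation property and almost innerness *)

Definition shift k : 'End(W) :=
  \sum_(2 <= j < n.+1) linfun (elem_map j (j + k)).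

Lemma shiftE k x :
  shift k x = \sum_(2 <= j < n.+1) witt_coord j x *: e (j + k).
Proof. by rewrite sum_lfunE; apply: eq_bigr => j _; rewrite lfunE. Qed.

Lemma shift_e k m : shift k (e m) = if (2 <= m)%N then e (m + k) else 0.
Proof.
rewrite shiftE big_nat.
rewrite (eq_bigr (fun j => if j == m then e (m + k) else 0)); last first.
  move=> j jn; rewrite witt_coord_e; last lia.
  by case: eqP => [->|_]; rewrite ?scale1r ?scale0r.
rewrite -big_nat -big_mkcond /= big_nat1_eq ltnS.
case: (ltnP n m) => [nm|_]; last by rewrite andbT.
by rewrite andbF witt_e_gt ?if_same //; lia.
Qed.

Lemma witt_coord_shift k l x : (0 < l <= n)%N ->
  witt_coord l (shift k x) = if (k + 2 <= l)%N then witt_coord (l - k) x else 0.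
Proof.
move=> ln; rewrite shiftE witt_coord_sum big_nat.
rewrite (eq_bigr (fun j => if j == (l - k)%N then witt_coord (l - k) x else 0));
    last first.
  move=> j j2; rewrite witt_coordZ witt_coord_e //.
  rewrite (_ : (l == j + k)%N = (j == l - k)%N); last by apply/eqP/eqP; lia.
  by case: eqP => [->|_]; rewrite ?mulr1 ?mulr0.
rewrite -big_nat -big_mkcond /= big_nat1_eq; congr (if _ then _ else _); lia.
Qed.

Lemma ad_e1 : ad (e 1) = shift 1.
Proof.
apply: witt_endP => j j0; rewrite adE shift_e.
case: ifP => [j2|j1]; first by rewrite witt_lie_e1 ?addn1.
have -> : j = 1%N by lia.
by rewrite liexx.
Qed.

(** Only pairs involving [e_1] need the commutation with [ad e_1]; for the other
    pairs [2 <= i < j], one has [i + j >= 5] and all three terms have degree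
    [i + j + k > n]. *)
Lemma shift_derivation k : (n < k + 5)%N -> derivation (shift k).
Proof.
move=> nk; apply: derivation_basis => i j ij; rewrite !shift_e.
have [i1|i2] := leqP i 1.
  have -> : i = 1%N by lia.
  rewrite (_ : (1 < j)%N); last lia.
  by rewrite lie0l add0r !witt_lie_e1 ?shift_e ?addSn ?ifT //; lia.
rewrite ifT; last lia.
rewrite !witt_lie_e ?linearZ /= ?shift_e; try lia.
by rewrite !ifT ?witt_e_gt ?scaler0 ?addr0 //; lia.
Qed.

(** If [x] starts at index [m <= 4] then [shift k x] starts at index at least
    [m + k > 2 * m], and otherwise it is zero since [n - k <= 4]. *)
Lemma shift_AID k : (4 < k)%N -> (n < k + 5)%N -> AID (shift k).
Proof.
move=> k4 nk; split=> [|x]; first exact: shift_derivation.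
have [/existsP[j0 xj0]|/existsPn x0] := boolP [exists j : 'I_5, witt_coord j x != 0].
  have ex : exists j, witt_coord j x != 0 by exists j0.
  case: (ex_minnP ex) => m xm min_m; have m4 := min_m _ xj0.
  have m_lt5 := leq_ltn_trans m4 (ltn_ord j0).
  have x_lt j : (j < m)%N -> witt_coord j x = 0.
    by move=> jm; apply/eqP; apply: contraTT jm => /min_m; rewrite -leqNgt.
  apply: (lead_bracket_image xm x_lt) => l l2m.
  have [nl|ln] := ltnP n l.
    rewrite /witt_coord /coordinate big_pred0 // => i.
    by apply/eqP; have := ltn_ord i; lia.
  rewrite witt_coord_shift; last lia.
  by rewrite x_lt ?if_same //; lia.
exists 0; rewrite lie0l; apply: witt_coordP => l ln.
rewrite witt_coordv0 witt_coord_shift //; case: ifP => // kl.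
have lk5 : (l - k < 5)%N by lia.
by have /negbNE/eqP /= -> := x0 (Ordinal lk5).
Qed.

(** * Reduction of an almost inner derivation to shifts *)

(** A derivation killing [e_1] commutes with [ad e_1], and [e_2] generates the
    span of the [e_j], [j >= 2], under [ad e_1]; so it is known from [D e_2]. *)
Lemma shift_cent D :
  derivation D -> D (e 1) = 0 -> witt_coord 1 (D (e 2)) = 0 ->
  D = \sum_(0 <= k < n.-1) witt_coord (k + 2) (D (e 2)) *: shift k.
Proof.
move=> dD De1 De2_1; apply: witt_endP => m m0; rewrite sum_lfunE.
have [m1|m2] := leqP m 1.
  have -> : m = 1%N by lia.
  by rewrite De1 big1 // => k _; rewrite scale_lfunE shift_e scaler0.
have -> : D (e m) = \sum_(0 <= k < n.-1) witt_coord (k + 2) (D (e 2)) *: e (m + k).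
  elim: m m2 {m0} => // m IHm; rewrite ltnS leq_eqVlt => /orP[/eqP <-|m2].
    rewrite -{1}(witt_coordK (D (e 2))).
    have [n0|n_gt0] := posnP n; first by rewrite !big_geq //; lia.
    rewrite big_ltn; last lia.
    rewrite De2_1 scale0r add0r -[2%N]/(0 + 2)%N big_addn.
    rewrite (_ : n.+1 - 2 = n.-1)%N; last lia.
    by apply: eq_bigr => k _; rewrite addnC.
  rewrite -witt_lie_e1 // dD De1 lie0l add0r IHm // lie_sumr.
  by apply: eq_bigr => k _; rewrite lieZr witt_lie_e1 ?addSn //; lia.
by apply: eq_bigr => k _; rewrite scale_lfunE shift_e m2.
Qed.

(** The components on [e_(k + 5)] of the Leibniz rule for [[e_2, e_3] = e_5] all
    are multiples of the same coefficient [v]. *)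
Lemma shift_coef_eq0 D k :
  derivation D -> D (e 1) = 0 -> witt_coord 1 (D (e 2)) = 0 ->
  (1 < k)%N -> (k + 5 <= n)%N -> witt_coord (k + 2) (D (e 2)) = 0.
Proof.
move=> dD De1 De2_1 k1 kn; set v := witt_coord _ _.
have coordD m : (2 <= m)%N -> (k + m <= n)%N -> witt_coord (k + m) (D (e m)) = v.
  elim: m => // m IHm; rewrite ltnS leq_eqVlt => /orP[/eqP <- //|m2] km.
  rewrite -witt_lie_e1 // dD De1 lie0l add0r witt_coord_lie_e; try lia.
  rewrite (_ : k + m.+1 - 1 = k + m)%N; last lia.
  by rewrite witt_coef1 ?IHm ?mul1r //; lia.
have c23 : c 2 3 = 1.
  rewrite witt_coef_ge2; try lia.
  by rewrite (_ : 'C(_, _) = 1%N) ?divff //; apply: natr_neq0.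
have := congr1 (witt_coord (k + 5)) (dD (e 2) (e 3)).
rewrite witt_lie_e // c23 scale1r coordD // witt_coordD [lie (D _) _]lieC.
rewrite witt_coordN !witt_coord_lie_e; try lia.
have k53 : (k + 5 - 3 = k + 2)%N by lia.
have k52 : (k + 5 - 2 = k + 3)%N by lia.
rewrite k53 k52.
rewrite !coordD -/v; try lia.
move/eqP; rewrite -mulNr -mulrDl addrC -subr_eq0 -{1}[v]mul1r -mulrBl mulf_eq0.
rewrite subr_eq0 eq_sym (negPf (witt_coef_defect k1 kn)) /=; exact: eqP.
Qed.

(** Evaluation at [e_1] kills the coordinates [2, ..., n - 1] of [y], and
    evaluation at [e_2] then isolates [a1], [a2], [a3] on [e_n], [e_(n - 1)],
    [e_(n - 2)]. *)
Lemma ad_eq_shifts_eq0 y a1 a2 a3 : (9 <= n)%N ->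
  ad y = a1 *: shift (n - 2) + a2 *: shift (n - 3) + a3 *: shift (n - 4) ->
  [/\ a1 = 0, a2 = 0 & a3 = 0].
Proof.
move=> n9 ad_y.
have adyE x : lie y x
    = a1 *: shift (n - 2) x + a2 *: shift (n - 3) x + a3 *: shift (n - 4) x.
  by rewrite -adE ad_y !add_lfunE !scale_lfunE.
have y0 k : (2 <= k < n)%N -> witt_coord k y = 0.
  move=> kn; have := congr1 (witt_coord k.+1) (adyE (e 1)).
  rewrite !shift_e !scaler0 !addr0 witt_coordv0 lieC witt_coordN witt_coord_lie_e; try lia.
  by rewrite subn1 /= witt_coef1 // mul1r => /eqP; rewrite oppr_eq0 => /eqP.
have ye2 k : (4 <= k <= n)%N -> witt_coord k (lie y (e 2)) = 0.
  move=> kn; rewrite lieC witt_coordN witt_coord_lie_e; try lia.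
  have [->|k4] := eqVneq k 4%N; first by rewrite witt_coefxx mul0r oppr0.
  by rewrite y0 ?mulr0 ?oppr0 //; lia.
have := conj (ye2 n) (conj (ye2 n.-1) (ye2 n.-2)).
rewrite adyE !shift_e !witt_coordD !witt_coordZ !witt_coord_e; try lia.
have n2 : (2 + (n - 2) = n)%N by lia.
have n3 : (2 + (n - 3) = n.-1)%N by lia.
have n4 : (2 + (n - 4) = n.-2)%N by lia.
rewrite n2 n3 n4.
have [-> -> ->] : [/\ (n == n.-1) = false, (n == n.-2) = false
                    & (n.-1 == n.-2) = false] by split; lia.
have [-> -> ->] : [/\ (n.-1 == n) = false, (n.-2 == n) = false
                    & (n.-2 == n.-1) = false] by split; lia.
rewrite !eqxx !mulr0 !mulr1 !addr0 !add0r => -[a1E [a2E a3E]].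
by rewrite a1E ?a2E ?a3E //; lia.
Qed.

Lemma sum_four_terms (V : zmodType) (F : nat -> V) : (9 <= n)%N ->
  F 0%N = 0 -> (forall k, (1 < k < n - 4)%N -> F k = 0) ->
  \sum_(0 <= k < n.-1) F k = F 1%N + (F (n - 2)%N + F (n - 3)%N + F (n - 4)%N).
Proof.
move=> n9 F0 F_mid.
have k1 : (n.-1 = (n - 4).+3)%N by lia.
have k2 : (n - 2 = (n - 4).+2)%N by lia.
have k3 : (n - 3 = (n - 4).+1)%N by lia.
rewrite k1 k2 k3; have : (5 <= n - 4)%N by lia.
move: (n - 4)%N F_mid => m F_mid m5; rewrite 3?big_nat_recr //=.
rewrite big_ltn; last lia.
rewrite big_ltn; last lia.
rewrite big_nat big1 // F0 add0r addr0 -!addrA; congr (_ + _).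
by rewrite addrCA [RHS]addrCA (addrC (F m)).
Qed.

(** Adding a multiple of [e_1] to [y] absorbs the term [shift 1 = ad e_1]. *)
Lemma AID_reduce D : (9 <= n)%N -> AID D ->
  exists y a1 a2 a3,
    D = ad y + (a1 *: shift (n - 2) + a2 *: shift (n - 3) + a3 *: shift (n - 4)).
Proof.
move=> n9 aidD; have [y De1] := aidD.2 (e 1); pose D1 := D - ad y.
have aidD1 : AID D1.
  by apply: AIDD => //; rewrite -scaleN1r; apply: AIDZ; exact: AID_ad.
have D1e1 : D1 (e 1) = 0 by rewrite add_lfunE opp_lfunE adE De1 subrr.
have D1e2 l : (l < 3)%N -> witt_coord l (D1 (e 2)) = 0.
  by move=> l3; have [z ->] := aidD1.2 (e 2); exact: witt_coord_lie_lt3.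
have [a D1a] : exists a, D1 = a 3%N *: ad (e 1)
    + (a n *: shift (n - 2) + a n.-1 *: shift (n - 3) + a n.-2 *: shift (n - 4)).
  exists (fun k => witt_coord k (D1 (e 2))).
  rewrite {1}(shift_cent aidD1.1 D1e1 (D1e2 1 isT)).
  rewrite (sum_four_terms n9).
  - rewrite -ad_e1.
    have k2 : (n - 2 + 2 = n)%N by lia.
    have k3 : (n - 3 + 2 = n.-1)%N by lia.
    have k4 : (n - 4 + 2 = n.-2)%N by lia.
    by rewrite k2 k3 k4.
  - by rewrite D1e2 ?scale0r.
  - move=> k kn; rewrite (shift_coef_eq0 aidD1.1 D1e1) ?scale0r //; try lia.
    exact: D1e2.
exists (y + a 3%N *: e 1), (a n), (a n.-1), (a n.-2).
by rewrite linearD linearZ /= -addrA -D1a addrC subrK.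
Qed.

(** * The three exceptional derivations as shifts *)

Lemma t1_shift : (4 <= n)%N -> t1 charK n = shift (n - 2).
Proof.
move=> n4; apply/lfunP => x; rewrite t1E shiftE big_ltn ?subnKC; try lia.
rewrite big_nat big1 ?addr0 // => j jn.
by rewrite witt_e_gt ?scaler0 //; lia.
Qed.

Lemma t2_shift : (4 <= n)%N -> t2 charK n = shift (n - 3).
Proof.
move=> n4; apply/lfunP => x; rewrite t2E shiftE; do 2 (rewrite big_ltn; last lia).
rewrite big_nat big1 ?addr0 => [|j jn]; last by rewrite witt_e_gt ?scaler0 //; lia.
by congr (_ *: e _ + _ *: e _); lia.
Qed.

Lemma t3_shift : (4 <= n)%N -> t3 charK n = shift (n - 4).
Proof.
move=> n4; apply/lfunP => x; rewrite t3E shiftE; do 3 (rewrite big_ltn; last lia).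
rewrite big_nat big1 ?addr0 => [|j jn]; last by rewrite witt_e_gt ?scaler0 //; lia.
by rewrite addrA; congr (_ *: e _ + _ *: e _ + _ *: e _); lia.
Qed.

End Witt.

Theorem proposition4p5 (K : fieldType) (charK : [pchar K] =i pred0) (n : nat)
    (n_ge9 : (9 <= n)%N) :
  directv (Inn (witt charK n) + <<[:: t1 charK n; t2 charK n; t3 charK n]>>)
  /\ forall D : 'End(witt charK n),
       AID D <->
       D \in (Inn (witt charK n)
              + <<[:: t1 charK n; t2 charK n; t3 charK n]>>)%VS.
Proof.
rewrite t1_shift ?t2_shift ?t3_shift; try lia.
have spanP (D : 'End(witt charK n)) :
    D \in <<[:: shift charK n (n - 2); shift charK n (n - 3);
                shift charK n (n - 4)]>>%VS ->
    exists a1 a2 a3, D = a1 *: shift charK n (n - 2) + a2 *: shift charK n (n - 3)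
                         + a3 *: shift charK n (n - 4).
  rewrite !span_cons span_nil addv0.
  move=> /memv_addP[_ /vlineP[a1 ->]
    [_ /memv_addP[_ /vlineP[a2 ->] [_ /vlineP[a3 ->] ->]] ->]].
  by exists a1, a2, a3; rewrite addrA.
split=> [|D].
  apply/directv_addP/eqP; rewrite -subv0; apply/subvP => D.
  rewrite memv_cap memv0 => /andP[/InnP[y ->] /spanP[a1 [a2 [a3 ad_y]]]].
  have [a10 a20 a30] := ad_eq_shifts_eq0 n_ge9 ad_y.
  by rewrite ad_y a10 a20 a30 !scale0r !addr0.
split=> [/(AID_reduce n_ge9)[y [a1 [a2 [a3 ->]]]] | ].
  rewrite memv_add //; first by apply/InnP; exists y.
  by rewrite !memvD ?memvZ ?memv_span // !inE eqxx ?orbT.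
move=> /memv_addP[_ /InnP[y ->] [_ /spanP[a1 [a2 [a3 ->]]] ->]].
by do !apply: AIDD; first [exact: AID_ad | apply: AIDZ; apply: shift_AID; lia].
Qed.
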